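(* Consider the network system with subsystems $\Sigma_i$: $x_i^+=f_i(x_i,y_{\mathcal N_i},u_i,d_i)$, $y_i=h_i(x_i)$, $i=1,\dots,N$. For each $i$ consider the parameterized assumption and guarantee $$\varphi_a^i(y_{\mathcal N_i}^{\max}):=\square\,|y_{\mathcal N_i}|\le y_{\mathcal N_i}^{\max},\qquad \varphi_g^i(\bar y_i^{\max}):=\square\,|y_i|\le\bar y_i^{\max}.$$ Suppose there exist monotonically increasing functions $\lambda_i$ ($i=1,\dots,N$), mapping nonnegative bounds $y_{\mathcal N_i}^{\max}$ to nonnegative bounds on $|y_i|$, such that for every $i$ and every $y_{\mathcal N_i}^{\max}\ge 0$, subsystem $\Sigma_i$ satisfies $$\varphi_a^i(y_{\mathcal N_i}^{\max})\ \Rightarrow\ \varphi_g^i\big(\lambda_i(y_{\mathcal N_i}^{\max})\big).$$ Suppose also that there is a vector of bounds $y^{\max}[0]\ge 0$ such that $$\forall i=1,\dots,N,\quad \lambda_i\big(y_{\mathcal N_i}^{\max}[0]\big)\le y_i^{\max}[0].$$ Then the network system satisfies $$|y(0)|\le y^{\max}[0]\quad\Rightarrow\quad\square\,|y|\le\Lambda(y^{\max}[0]),$$ where $\Lambda(y^{\max})=\big(\lambda_1(y_{\mathcal N_1}^{\max}),\dots,\lambda_N(y_{\mathcal N_N}^{\max})\big)$.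
   Context: For $i=1,\dots,N$, subsystem $\Sigma_i$ is a discrete-time system with state $x_i\in\mathcal X_i\subseteq\mathbb R^{n_i}$, control $u_i\in\mathcal U_i\subseteq\mathbb R^{m_i}$, disturbance $d_i\in\mathcal D_i\subseteq\mathbb R^{l_i}$, output $y_i\in\mathcal Y_i\subseteq\mathbb R^{s_i}$, dynamics $f_i:\mathcal X_i\times\prod_{j\in\mathcal N_i}\mathcal Y_j\times\mathcal U_i\times\mathcal D_i\to\mathcal X_i$ and output map $h_i:\mathcal X_i\to\mathcal Y_i$ with $h_i(0)=0$ (the origin being the operating point). $\mathcal N_i$ is the set of indices of the neighbours of $\Sigma_i$ and $y_{\mathcal N_i}$ is the stacked vector of outputs $y_j$, $j\in\mathcal N_i$; likewise $y_{\mathcal N_i}^{\max}$ is the corresponding subvector of $y^{\max}=(y_1^{\max},\dots,y_N^{\max})$. Absolute values, inequalities and monotonicity for vectors are componentwise; $y=(y_1,\dots,y_N)$. A trajectory of $\Sigma_i$ is a tuple of sequences $(x_i,y_{\mathcal N_i},u_i,d_i,y_i)(t)$, $t=0,1,2,\dots$, with $x_i(t)\in\mathcal X_i$, $y_{\mathcal N_i}(t)\in\prod_{j\in\mathcal N_i}\mathcal Y_j$, $u_i(t)\in\mathcal U_i$, $d_i(t)\in\mathcal D_i$, $y_i(t)\in\mathcal Y_i$, satisfying $x_i(t+1)=f_i(x_i(t),y_{\mathcal N_i}(t),u_i(t),d_i(t))$ and $y_i(t)=h_i(x_i(t))$ for all $t$; here $y_{\mathcal N_i}(\cdot)$ is an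 arbitrary input sequence. A trajectory of the network is a tuple of sequences $(x,y,u,d)(\cdot)$ whose restriction to each $i$ is a trajectory of $\Sigma_i$. ''$\Sigma_i$ (or the network) satisfies $\phi\Rightarrow\psi$'' means that every trajectory of it satisfying $\phi$ satisfies $\psi$. $\square\,\psi$ means that $\psi$ holds at all times $t=0,1,2,\dots$. *)

(* Defs.v *)
From HB Require Import structures.
From mathcomp Require Import all_boot all_order all_algebra.
From mathcomp Require Import classical_sets reals.

Set Implicit Arguments.
Unset Strict Implicit.
Unset Printing Implicit Defensive.

Import Order.TTheory GRing.Theory Num.Theory.
Local Open Scope ring_scope.

Definition vabs (R : realType) (n : nat) (v : 'cV[R]_n) : 'cV[R]_n :=
  map_mx Num.norm v.

Definition vle (R : realType) (n : nat) (v w : 'cV[R]_n) : Prop :=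
  forall k : 'I_n, v k 0 <= w k 0.

(** A stacked vector is kept as the family of its blocks, where block [j]
    lives in R^(s j). *)
Definition bvec (R : realType) (J : Type) (s : J -> nat) : Type :=
  forall j : J, 'cV[R]_(s j).

Definition babs (R : realType) (J : Type) (s : J -> nat) (v : bvec R s) :
  bvec R s := fun j => vabs (v j).

Definition ble (R : realType) (J : Type) (s : J -> nat) (v w : bvec R s) :
  Prop := forall j, vle (v j) (w j).

Definition bzero (R : realType) (J : Type) (s : J -> nat) : bvec R s :=
  fun j => 0.
Arguments bzero {R J s}.

Definition nbr (N : nat) (A : {set 'I_N}) : Type := {j : 'I_N | j \in A}.

(** The maps [dyn i] and [out i] are total on the ambient spaces; only their
    values on the constraint sets matter, and the fields [dynP] and [outP] say
    that they restrict to maps X_i * prod_(j in N_i) Y_j * U_i * D_i -> X_i and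
    X_i -> Y_i. The origin has to be a state for the equation h_i(0) = 0 to
    make sense, hence the field [state0]. *)
Record network (R : realType) (N : nat) := Network {
  dimx : 'I_N -> nat;
  dimu : 'I_N -> nat;
  dimd : 'I_N -> nat;
  dimy : 'I_N -> nat;
  neigh : 'I_N -> {set 'I_N};
  stateS : forall i, set 'cV[R]_(dimx i);
  ctrlS : forall i, set 'cV[R]_(dimu i);
  distS : forall i, set 'cV[R]_(dimd i);
  outS : forall i, set 'cV[R]_(dimy i);
  dyn : forall i, 'cV[R]_(dimx i) ->
          bvec R (fun j : nbr (neigh i) => dimy (val j)) ->
          'cV[R]_(dimu i) -> 'cV[R]_(dimd i) -> 'cV[R]_(dimx i);
  out : forall i, 'cV[R]_(dimx i) -> 'cV[R]_(dimy i);
  dynP : forall i x (z : bvec R (fun j : nbr (neigh i) => dimy (val j))) u d,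
    stateS x -> (forall j, outS (z j)) -> ctrlS u -> distS d ->
    stateS (@dyn i x z u d);
  outP : forall i (x : 'cV[R]_(dimx i)), stateS x -> outS (@out i x);
  state0 : forall i, stateS (0 : 'cV[R]_(dimx i));
  out0 : forall i, @out i 0 = 0
}.

Arguments stateS {R N} n i _.
Arguments ctrlS {R N} n i _.
Arguments distS {R N} n i _.
Arguments outS {R N} n i _.
Arguments dyn {R N} n i _ _ _ _.
Arguments out {R N} n i _.

(** Network outputs [y] (also vectors of bounds on them), and stacked
    vectors of neighbour outputs (also bounds on them). *)
Definition outvec (R : realType) (N : nat) (G : network R N) : Type :=
  bvec R (dimy G).

Definition nbrvec (R : realType) (N : nat) (G : network R N) (i : 'I_N) :
  Type := bvec R (fun j : nbr (neigh G i) => dimy G (val j)).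

Definition to_nbr (R : realType) (N : nat) (G : network R N) (i : 'I_N)
  (y : outvec G) : nbrvec G i := fun j => y (val j).
Arguments to_nbr {R N G} i y.

Record sub_signal (R : realType) (N : nat) (G : network R N) (i : 'I_N) :=
  SubSignal {
    sx : nat -> 'cV[R]_(dimx G i);
    sz : nat -> nbrvec G i;
    su : nat -> 'cV[R]_(dimu G i);
    sd : nat -> 'cV[R]_(dimd G i);
    sy : nat -> 'cV[R]_(dimy G i)
  }.

Definition sub_trajectory (R : realType) (N : nat) (G : network R N)
  (i : 'I_N) (w : sub_signal G i) : Prop :=
  forall t : nat,
    [/\ [/\ stateS G i (sx w t),
            forall j : nbr (neigh G i), outS G (val j) (sz w t j),
            ctrlS G i (su w t), distS G i (sd w t) & outS G i (sy w t)],
        sx w t.+1 = dyn G i (sx w t) (sz w t) (su w t) (sd w t)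
      & sy w t = out G i (sx w t)].

Record net_signal (R : realType) (N : nat) (G : network R N) := NetSignal {
  nx : nat -> forall i, 'cV[R]_(dimx G i);
  ny : nat -> outvec G;
  nu : nat -> forall i, 'cV[R]_(dimu G i);
  nd : nat -> forall i, 'cV[R]_(dimd G i)
}.

Definition restr (R : realType) (N : nat) (G : network R N)
  (w : net_signal G) (i : 'I_N) : sub_signal G i :=
  {| sx := fun t => nx w t i;
     sz := fun t => to_nbr i (ny w t);
     su := fun t => nu w t i;
     sd := fun t => nd w t i;
     sy := fun t => ny w t i |}.

Definition net_trajectory (R : realType) (N : nat) (G : network R N)
  (w : net_signal G) : Prop := forall i, sub_trajectory (restr w i).

Definition always (P : nat -> Prop) : Prop := forall t : nat, P t.

Definition sub_satisfies (R : realType) (N : nat) (G : network R N) (i : 'I_N)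
  (phi psi : sub_signal G i -> Prop) : Prop :=
  forall w, sub_trajectory w -> phi w -> psi w.

Definition net_satisfies (R : realType) (N : nat) (G : network R N)
  (phi psi : net_signal G -> Prop) : Prop :=
  forall w, net_trajectory w -> phi w -> psi w.

Definition assumption (R : realType) (N : nat) (G : network R N) (i : 'I_N)
  (b : nbrvec G i) (w : sub_signal G i) : Prop :=
  always (fun t => ble (babs (sz w t)) b).

Definition guarantee (R : realType) (N : nat) (G : network R N) (i : 'I_N)
  (b : 'cV[R]_(dimy G i)) (w : sub_signal G i) : Prop :=
  always (fun t => vle (vabs (sy w t)) b).

Definition Lambda (R : realType) (N : nat) (G : network R N)
  (lambda : forall i, nbrvec G i -> 'cV[R]_(dimy G i)) (b : outvec G) :
  outvec G := fun i => lambda i (to_nbr i b).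

(* Main.v *)
(** Contracts are causal: the output of a subsystem at time t+1 depends on its
    neighbours' outputs up to time t only. Freezing that input after time t thus
    gives a trajectory that satisfies the assumption for ever, so a bound on
    the inputs up to time t already yields the guarantee at time t+1. With the
    invariance of ymax0, induction on time bounds all outputs by ymax0 for ever;
    one last use of the contracts improves this to Lambda ymax0. *)

Require Import Defs.
From HB Require Import structures.
From mathcomp Require Import all_boot all_order all_algebra.
From mathcomp Require Import classical_sets reals.

Set Implicit Arguments.
Unset Strict Implicit.
Unset Printing Implicit Defensive.

Import Order.TTheory GRing.Theory Num.Theory.
Local Open Scope ring_scope.

Definition run (R : realType) (N : nat) (G : network R N) (i : 'I_N)
  (x0 : 'cV[R]_(dimx G i)) (z : nat -> nbrvec G i)
  (u : nat -> 'cV[R]_(dimu G i)) (d : nat -> 'cV[R]_(dimd G i)) :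
  nat -> 'cV[R]_(dimx G i) :=
  fix x t := if t is t'.+1 then dyn G i (x t') (z t') (u t') (d t') else x0.

(** The states are recomputed by [run], since those of [w] need not obey the dynamics once the input
    is held. *)
Definition freeze (R : realType) (N : nat) (G : network R N) (i : 'I_N)
  (t : nat) (w : sub_signal G i) : sub_signal G i :=
  let z := fun r => sz w (minn r t) in
  let x := run (sx w 0) z (su w) (sd w) in
  {| sx := x; sz := z; su := su w; sd := sd w; sy := fun r => out G i (x r) |}.

Lemma freeze_trajectory (R : realType) (N : nat) (G : network R N) (i : 'I_N)
  (t : nat) (w : sub_signal G i) :
  sub_trajectory w -> sub_trajectory (freeze t w).
Proof.
move=> wP.
(* Each held input is one that [w] takes at time [minn r t], hence admissible. *)
have xS r : stateS G i (sx (freeze t w) r).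
  elim: r => [|r IHr] /=; first by case: (wP 0) => -[].
  have [[_ _ uS dS _] _ _] := wP r.
  by have [[_ zS _ _ _] _ _] := wP (minn r t); apply: dynP.
move=> r; have [[_ _ uS dS _] _ _] := wP r.
have [[_ zS _ _ _] _ _] := wP (minn r t).
by split=> //; split=> //; apply: outP; apply: xS.
Qed.

(** The state at [t.+1] is computed from inputs up to time [t], and [out] reads the state alone, so
    agreement reaches one step past the freezing time. *)
Lemma freeze_output (R : realType) (N : nat) (G : network R N) (i : 'I_N)
  (t : nat) (w : sub_signal G i) (r : nat) :
  sub_trajectory w -> (r <= t.+1)%N -> sy (freeze t w) r = sy w r.
Proof.
move=> wP le_rt; have [_ _ ->] := wP r; rewrite /=; congr (out G i _).
elim: r le_rt => [//|r IHr] lt_rt /=.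
have [_ -> _] := wP r.
by rewrite IHr ?(ltnW lt_rt) // (minn_idPl _).
Qed.

Lemma contract_causal (R : realType) (N : nat) (G : network R N) (i : 'I_N)
  (b : nbrvec G i) (c : 'cV[R]_(dimy G i)) (w : sub_signal G i) (t : nat) :
  sub_satisfies (assumption b) (guarantee c) -> sub_trajectory w ->
  (forall r, (r <= t)%N -> ble (babs (sz w r)) b) ->
  vle (vabs (sy w t.+1)) c.
Proof.
move=> contract wP wb; rewrite -(freeze_output wP (leqnn t.+1)).
apply: contract; first exact: freeze_trajectory.
by move=> r; apply: wb; apply: geq_minr.
Qed.

Theorem lemma1 (R : realType) (N : nat) (G : network R N)
  (lambda : forall i : 'I_N, nbrvec G i -> 'cV[R]_(dimy G i))
  (lambda_ge0 : forall (i : 'I_N) (b : nbrvec G i),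
     ble bzero b -> vle 0 (lambda i b))
  (lambda_mono : forall (i : 'I_N) (b c : nbrvec G i),
     ble bzero b -> ble b c -> vle (lambda i b) (lambda i c))
  (contracts : forall (i : 'I_N) (b : nbrvec G i), ble bzero b ->
     sub_satisfies (assumption b) (guarantee (lambda i b)))
  (ymax0 : outvec G)
  (ymax0_ge0 : ble bzero ymax0)
  (ymax0_inv : forall i : 'I_N, vle (lambda i (to_nbr i ymax0)) (ymax0 i)) :
  net_satisfies (fun w : net_signal G => ble (babs (ny w 0%N)) ymax0)
    (fun w : net_signal G =>
       always (fun t => ble (babs (ny w t)) (Lambda lambda ymax0))).
Proof.
move=> w wP y0_le.
have nbr0_ge0 i : ble bzero (to_nbr i ymax0) by move=> j; apply: ymax0_ge0.
have y_le t : ble (babs (ny w t)) ymax0.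
  (* Strong induction, as the contract needs the neighbours' whole past; time 0 is the hypothesis
     [y0_le]. *)
  elim/ltn_ind: t => -[//|t] IHt i k.
  apply: le_trans (ymax0_inv i k).
  suff z_le r : (r <= t)%N -> ble (babs (sz (restr w i) r)) (to_nbr i ymax0).
    exact: (contract_causal (contracts i _ (nbr0_ge0 i)) (wP i) z_le).
  by move=> le_rt j; apply: IHt.
(* The assumption now holds at all times, so the contract applies to the trajectory itself and
   covers time 0 too, which [contract_causal] does not reach. *)
move=> t i; apply: (contracts i _ (nbr0_ge0 i) _ (wP i)) => r j.
exact: y_le.
Qed.
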